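(* Let $Y$ be a Hausdorff, connected, locally path connected, first countable topological space and let $S\subset Y$ be skeletal such that $Y\setminus S$ is semi-locally simply connected. Let $a\in Y\setminus S$. Let $p:\widetilde Y^S\to Y$ be the universal covering of $Y$ possibly branched over $S$. For each open connected $U\subset Y$, let $\pi_1(a,U)$ be the set of paths with fixed start $a$ and free end in $U$, up to homotopy. Then for all $b\in Y$ and all bases $\mathcal B$ of connected open neighborhoods of $b$ there is a homeomorphism $$p^{-1}(b)\simeq\varprojlim_{U\in\mathcal B}\pi_1(a,U),$$ with respect to the natural bonding maps $\pi_1(a,U)\to\pi_1(a,V)$ for $U\subset V$.
   Context: All topological spaces are Hausdorff, locally path connected and first countable (projective limits are taken in the category of Hausdorff topological spaces). A subset $D$ of a space $X$ is locally connected in $X$ if $U\cap D$ is connected for every open connected $U\subset X$. A subset is portly in $X$ if it is open, dense and locally connected in $X$; a subset is skeletal if its complement is portly. A spread $p:X\to Y$ is a continuous map such that the connected components of preimages $p^{-1}(U)$ of open subsets $U\subset Y$ generate the topology of $X$. It is complete if for every $y\in\overline{p(X)}$ and every inclusion-increasing assignment $\chi$ associating to each open connected neighborhood $U$ of $y$ a connected component $\chi(U)$ of $p^{-1}(U)$, one has $\bigcap_U\chi(U)\neq\emptyset$. A completion of a spread $X\to Y$ is a complete spread $X'\to Y$ with an embedding $X\to X'$ over $Y$ whose image is open, dense and locally connected in $X'$; every spread has a completion, unique up to isomorphism. A space $Z$ is semi-locally simply connected if every point $z$ has a neighborhood $U$ such that every loop in $U$ based at $z$ is null-homotopic in $Z$.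 The universal covering $\widetilde Y^S\to Y$ possibly branched over $S$ is the completion of the spread $\widetilde{Y\setminus S}\to Y$, where $\widetilde{Y\setminus S}$ is the universal covering of $Y\setminus S$. The paths considered in $\pi_1(a,U)$ are paths in $Y\setminus S$ starting at $a$ and ending in $U\setminus S$, and homotopies are homotopies through such paths (start fixed at $a$, end free in $U\setminus S$). The sets $\pi_1(a,U)$ carry the discrete topology. *)

(* Defs.v *)
From HB Require Import structures.
From mathcomp Require Import all_boot all_order all_algebra.
From mathcomp Require Import lra.
From mathcomp Require Import all_classical reals topology normedtype.
Import Order.TTheory GRing.Theory Num.Theory.
Import numFieldNormedType.Exports.

Set Implicit Arguments.
Unset Strict Implicit.
Unset Printing Implicit Defensive.

Local Open Scope classical_set_scope.
Local Open Scope ring_scope.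

Definition homeomorphic (T U : topologicalType) : Prop :=
  exists (f : T -> U) (g : U -> T),
    [/\ continuous f, continuous g, cancel f g & cancel g f].

Definition embedding (T U : topologicalType) (f : T -> U) : Prop :=
  injective f /\
  forall A : set T, open A <-> exists2 B : set U, open B & A = f @^-1` B.

Definition first_countable (T : topologicalType) : Prop :=
  forall x : T, exists2 B : set (set T),
    countable B & nbhs x = filter_from B id.

Definition connected_nbhs_basis (T : topologicalType) (x : T)
    (B : set (set T)) : Prop :=
  (forall U, B U -> open_nbhs x U /\ connected U) /\ filter_from B id --> x.

Definition locally_connected_in (T : topologicalType) (D : set T) : Prop :=
  forall U : set T, open U -> connected U -> connected (U `&` D).

Definition portly (T : topologicalType) (D : set T) : Prop :=
  [/\ open D, dense D & locally_connected_in D].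

Definition skeletal (T : topologicalType) (S : set T) : Prop :=
  portly (~` S).

(** Paths and homotopies. Only the restriction of a path to `[0, 1] (resp. of
    a homotopy to the unit square) matters: homotopy of paths does not see the
    values outside. *)

Section Paths.
Context (R : realType) (T : topologicalType).
Implicit Types (a : T) (U V : set T).

Local Notation I := (`[0, 1]%classic : set R).

Definition path_to a U : set (R -> T) :=
  [set f | [/\ {within I, continuous f}, f 0 = a & U (f 1)]].

(** Homotopies through paths with start fixed at [a] and end free in [U]; when
    [U] is a singleton this is homotopy relative to the endpoints. *)
Definition homotopic_to a U (f g : R -> T) : Prop :=
  exists H : R * R -> T,
    [/\ {within I `*` I, continuous H},
        forall t, t \in `[0, 1] -> H (0, t) = f t,
        forall t, t \in `[0, 1] -> H (1, t) = g t &
        forall s, s \in `[0, 1] -> H (s, 0) = a /\ U (H (s, 1))].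

Definition path_connected (A : set T) : Prop :=
  forall x y, A x -> A y ->
    exists2 f, path_to x [set y] f & f @` I `<=` A.

Definition locally_path_connected : Prop :=
  forall (x : T) (A : set T), nbhs x A ->
    exists U, [/\ open_nbhs x U, path_connected U & U `<=` A].

Definition null_homotopic (x : T) (f : R -> T) : Prop :=
  homotopic_to x [set x] f (cst x).

Definition simply_connected : Prop :=
  [/\ [set: T] !=set0, path_connected [set: T] &
      forall x f, path_to x [set x] f -> null_homotopic x f].

Definition semi_locally_simply_connected : Prop :=
  forall x : T, exists2 U, nbhs x U &
    forall f, path_to x [set x] f -> f @` I `<=` U ->
      null_homotopic x f.

(** Standing assumptions on all the spaces involved. *)
Definition admissible : Prop :=
  [/\ hausdorff_space T, locally_path_connected & first_countable T].

Lemma homotopic_to_refl a U f : path_to a U f -> homotopic_to a U f f.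
Proof.
move=> [/subspace_continuousP cf f0 f1]; exists (f \o snd); split => //.
apply/subspace_continuousP => -[s t] [/= _ It] W /(cf t It) fW.
exists (setT, [set y | I y -> W (f y)]).
  by split; [exact: (@filterT _ (nbhs s) _)|exact: fW].
by move=> [u v] /= [_ vW] [_ /vW].
Qed.

Lemma homotopic_to_comp_subproof (A B : set (R * R)) (H : R * R -> T)
    (phi : R * R -> R * R) :
  continuous phi -> (forall z, A z -> B (phi z)) ->
  {within B, continuous H} -> {within A, continuous (H \o phi)}.
Proof.
move=> cphi phiAB /subspace_continuousP cH; apply/subspace_continuousP => z Az.
move=> W /= /(cH _ (phiAB _ Az)) HW.
have zW : nbhs z (phi @^-1` [set w | B w -> W (H w)]) := cphi z _ HW.
by apply: filterS zW => w /= wW /phiAB.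
Qed.

Lemma continuous_fst_subproof (u : R -> R) :
  continuous u -> continuous (fun z : R * R => (u z.1, z.2)).
Proof.
move=> cu [s t] W [[P Q] [/= Ps Qt] PQ].
exists (u @^-1` P, Q); first by split => //; exact: cu.
by move=> [x y] [/= Px Qy]; exact: PQ.
Qed.

Lemma closed_itvX_subproof (x y : R) : closed (`[x, y]%classic `*` I).
Proof.
rewrite (_ : _ `*` _ = fst @^-1` `[x, y]%classic `&` snd @^-1` I)//.
apply: closedI.
  by apply: preimage_closed => [z _|]; [exact: cvg_fst|exact: itv_closed].
by apply: preimage_closed => [z _|]; [exact: cvg_snd|exact: itv_closed].
Qed.

Lemma homotopic_to_sym a U f g : homotopic_to a U f g -> homotopic_to a U g f.
Proof.
move=> [H [cH H0 H1 Ha]].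
have rev01 (s : R) : s \in `[0, 1] -> 1 - s \in `[0, 1].
  by rewrite !in_itv/= => /andP[? ?]; rewrite subr_ge0 lerBlDr lerDl; apply/andP.
exists (H \o (fun z => (1 - z.1, z.2))); split => /=.
- apply: (homotopic_to_comp_subproof _ _ cH) => [z|[s t] [/= /rev01 ? ?]//].
  apply: (@continuous_fst_subproof (fun s => 1 - s)) => s.
  by apply: cvgB; [exact: cvg_cst|exact: cvg_id].
- by move=> t t01; rewrite subr0 H1.
- by move=> t t01; rewrite subrr H0.
- by move=> s /rev01 /Ha.
Qed.

Lemma homotopic_to_trans a U f g h :
  homotopic_to a U f g -> homotopic_to a U g h -> homotopic_to a U f h.
Proof.
move=> [H [cH H0 H1 Ha]] [K [cK K0 K1 Ka]].
pose L (z : R * R) := if z.1 <= 2^-1 then H (2 * z.1, z.2)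
                      else K (2 * z.1 - 1, z.2).
have lo (s : R) : 0 <= s -> s <= 2^-1 -> 2 * s \in `[0, 1].
  by move=> s0 s1; rewrite in_itv/=; apply/andP; split; lra.
have hi (s : R) : 2^-1 <= s -> s <= 1 -> 2 * s - 1 \in `[0, 1].
  by move=> s0 s1; rewrite in_itv/=; apply/andP; split; lra.
exists L; split.
- have -> : I `*` I =
      (`[0, 2^-1]%classic `*` I) `|`
      (`[2^-1, 1]%classic `*` I) :> set (R * R).
    apply/seteqP; split => -[s t] /=; rewrite !in_itv/=.
      move=> [/andP[s0 s1] t01]; case: (leP s 2^-1) => s2; [left|right].
        by split => //; rewrite s0.
      by split => //; rewrite (ltW s2).
    by move=> [[/andP[s0 s2] t01]|[/andP[s2 s1] t01]]; split => //;
      apply/andP; split => //; lra.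
  apply: withinU_continuous.
  + exact: closed_itvX_subproof.
  + exact: closed_itvX_subproof.
  + apply: (@subspace_eq_continuous _ _ _ (H \o (fun z => (2 * z.1, z.2)))).
      move=> [s t] /set_mem[/=]; rewrite in_itv/= => /andP[_ s2] _.
      by rewrite /from_subspace /L /= s2.
    apply: (homotopic_to_comp_subproof _ _ cH) => [z|[s t] /= [+ ?]].
      apply: (@continuous_fst_subproof (fun s => 2 * s)) => s.
      by apply: cvgM; [exact: cvg_cst|exact: cvg_id].
    by rewrite in_itv/= => /andP[? ?]; split => //; exact: lo.
  + apply: (@subspace_eq_continuous _ _ _ (K \o (fun z => (2 * z.1 - 1, z.2)))).
      move=> [s t] /set_mem[/=]; rewrite in_itv/= => /andP[s2 _] t01.
      rewrite /from_subspace /L /=; case: ifPn => // s2'.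
      have -> : s = 2^-1 by apply/le_anti; rewrite s2 s2'.
      have -> : 2 * 2^-1 = 1 :> R by lra.
      by rewrite H1// subrr K0.
    apply: (homotopic_to_comp_subproof _ _ cK) => [z|[s t] /= [+ ?]].
      apply: (@continuous_fst_subproof (fun s => 2 * s - 1)) => s.
      apply: cvgB; last exact: cvg_cst.
      by apply: cvgM; [exact: cvg_cst|exact: cvg_id].
    by rewrite in_itv/= => /andP[? ?]; split => //; exact: hi.
- by move=> t t01; rewrite /L/= invr_ge0 ler0n mulr0 H0.
- move=> t t01; rewrite /L/= ifF; last by apply/negbTE; rewrite -ltNge; lra.
  have -> : 2 * 1 - 1 = 1 :> R by lra.
  exact: K1.
- move=> s; rewrite in_itv/= => /andP[s0 s1]; rewrite /L/=.
  by case: (leP s 2^-1) => [s2|/ltW s2]; [exact/Ha/lo|exact/Ka/hi].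
Qed.

End Paths.

Arguments path_to R {T} a U.

Section Pi1.
Local Open Scope quotient_scope.
Context (R : realType) (T : topologicalType) (a : T).
Implicit Types U V : set T.

Definition path_rel U (f g : path_to R a U) : bool :=
  `[< homotopic_to a U (\val f) (\val g) >].

Lemma path_rel_refl U : reflexive (@path_rel U).
Proof.
by move=> f; apply/asboolP/homotopic_to_refl; exact: set_mem (valP f).
Qed.

Lemma path_rel_sym U : symmetric (@path_rel U).
Proof. by move=> f g; apply/asboolP/asboolP; exact: homotopic_to_sym. Qed.

Lemma path_rel_trans U : transitive (@path_rel U).
Proof.
move=> g f h /asboolP fg /asboolP gh; apply/asboolP.
exact: homotopic_to_trans fg gh.
Qed.

Canonical path_equiv U :=
  EquivRel (@path_rel U) (@path_rel_refl U) (@path_rel_sym U)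
    (@path_rel_trans U).

Definition pi1 U := {eq_quot (path_equiv U)}.

Lemma path_incl_subproof U V (UV : U `<=` V) (f : path_to R a U) :
  \val f \in path_to R a V.
Proof. by have /set_mem[? ? /UV] := valP f; rewrite inE. Qed.

Definition path_incl U V (UV : U `<=` V) (f : path_to R a U) : path_to R a V :=
  exist _ (\val f) (path_incl_subproof UV f).

Definition pi1_map U V (UV : U `<=` V) (c : pi1 U) : pi1 V :=
  \pi_(pi1 V) (path_incl UV (repr c)).

Lemma pi1_mapE U V (UV : U `<=` V) (f : path_to R a U) :
  pi1_map UV (\pi_(pi1 U) f) = \pi_(pi1 V) (path_incl UV f).
Proof.
apply/eqmodP/asboolP => /=.
have : path_rel (repr (\pi_(pi1 U) f)) f by apply/eqmodP; rewrite reprK.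
move=> /asboolP[H [cH H0 H1 Ha]]; exists H.
by split => // s /Ha[-> /UV].
Qed.

End Pi1.

(** The limit, as a subspace of the product, of a system of spaces indexed by a
    type [I] with a relation [le], and bonding maps in the direction of [le]. *)
Definition projlim (I : Type) (le : I -> I -> Prop) (T : I -> topologicalType)
    (phi : forall i j, le i j -> T i -> T j) : set (prod_topology T) :=
  [set c | forall i j (ij : le i j), phi i j ij (c i) = c j].

(** A continuous map is a covering when every point has an open neighborhood
    [U] whose preimage is a disjoint union of open sets, each of which is mapped
    homeomorphically (bijectively and openly) onto [U]. *)
Definition covering (X Z : topologicalType) (q : X -> Z) : Prop :=
  continuous q /\
  forall z : Z, exists2 U : set Z, open_nbhs z U &
    exists F : set (set X),
      [/\ trivIset F id, \bigcup_(V in F) V = q @^-1` U &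
          forall V, F V ->
            [/\ open V, set_bij V U q &
                forall W, open W -> W `<=` V -> open (q @` W)]].

Definition universal_covering (R : realType) (X Z : topologicalType)
    (q : X -> Z) : Prop :=
  covering q /\ simply_connected R X.

Definition is_component (T : topologicalType) (A C : set T) : Prop :=
  exists2 x, A x & C = connected_component A x.

Definition spread (X Y : topologicalType) (p : X -> Y) : Prop :=
  continuous p /\
  basis [set C | exists2 U : set Y, open U & is_component (p @^-1` U) C].

Definition complete_spread (X Y : topologicalType) (p : X -> Y) : Prop :=
  spread p /\
  forall (y : Y) (chi : set Y -> set X),
    let N := [set U : set Y | open_nbhs y U /\ connected U] in
    closure (range p) y ->
    (forall U, N U -> is_component (p @^-1` U) (chi U)) ->
    (forall U V, N U -> N V -> U `<=` V -> chi U `<=` chi V) ->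
    \bigcap_(U in N) chi U !=set0.

(** [p], together with the embedding [j], is a completion of the spread [f]. *)
Definition is_completion (X X' Y : topologicalType) (f : X -> Y)
    (p : X' -> Y) (j : X -> X') : Prop :=
  [/\ spread f, complete_spread p, embedding j, p \o j = f &
      portly (range j)].

(** Universal coverings and completions being unique up to isomorphism only,
    "the" branched universal covering is given by a predicate on [p]. *)
Definition branched_universal_covering (R : realType) (Y : topologicalType)
    (S : set Y) (X' : topologicalType) (p : X' -> Y) : Prop :=
  admissible R X' /\
  exists (X : topologicalType) (q : X -> (~` S : set Y)) (j : X -> X'),
    [/\ admissible R X, universal_covering R q &
        is_completion (set_val \o q) p j].

Section BranchedPi1.
Context (R : realType) (Y : topologicalType) (S : set Y) (a : (~` S : set Y)).

(** Homotopy classes of paths in [Y \ S] from [a] to a free end in [U \ S]. *)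
Definition branched_pi1 (U : set Y) :=
  pi1 R a (set_val @^-1` U : set (~` S : set Y)).

Definition branched_pi1_map (U V : set Y) (UV : U `<=` V) :
    branched_pi1 U -> branched_pi1 V :=
  pi1_map (preimage_subset UV).

Definition branched_pi1_lim (B : set (set Y)) :=
  projlim (I := B)
    (le := fun U V => \val U `<=` \val V)
    (T := fun U => discrete_topology (branched_pi1 (\val U)))
    (fun U V => @branched_pi1_map (\val U) (\val V)).

End BranchedPi1.

Arguments branched_pi1_lim R {Y S} a B.

(* Main.v *)
Require Import Defs.
From mathcomp Require Import all_boot all_order all_algebra.
From mathcomp Require Import lra.
From mathcomp Require Import all_classical reals topology normedtype.
Import Order.TTheory GRing.Theory Num.Theory.
Import numFieldNormedType.Exports.

(** Let [q : X -> Y \ S] be the universal covering and [j : X -> X'] its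
    inclusion in the completion [p : X' -> Y]. The classes of paths from [a]
    into a connected open set [U] are the connected components of [p^-1(U)], and
    the points over [b] of a complete spread are the compatible families of such
    components.

    For the first claim, choose [x0] over [a] and send a path from [a] into [U]
    to the component of [p^-1(U)] that contains the end of its lift from [x0].
    This depends on the homotopy class only, since the end of a lifted homotopy
    moves in a connected set over [U] ([homotopic_lifts_connected]). Each
    component occurs, since it meets the dense open set [X], which is path
    connected. Two paths with the same component are homotopic: the component
    meets [X] in a connected open set, as [X] is locally connected in [X'], so
    the ends of the lifts can be joined in it, and simple connectedness of [X]
    fills the resulting loop ([homotopic_of_lifts]).

    For the second claim ([fibre_homeomorphic_projlim]), a point over [b]
    determines the components that contain it. They determine the point, as they
    form a neighbourhood base at it and [X'] is Hausdorff. Completeness provides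
    a point for each compatible family; it lies over [b] because [Y] is
    Hausdorff and the neighbourhoods in the family shrink to [b].

    The lifting properties of coverings are derived from one principle, that a
    locally constant property on a connected set is constant
    ([connected_locally_constant]). *)

Set Implicit Arguments.
Unset Strict Implicit.
Unset Printing Implicit Defensive.

Local Open Scope classical_set_scope.
Local Open Scope ring_scope.

(** * Locally constant predicates and gluing of continuous maps *)

(** The substitute for subdivisions of the interval in lifting arguments: a
    property of the parameter of a path that is insensitive to small moves of
    the parameter propagates from one end to the other, as the set where it
    holds is clopen. *)
Lemma connected_locally_constant (T : topologicalType) (A : set T)
    (P : T -> Prop) :
  connected A ->
  (forall x, A x -> exists2 N, nbhs x N &
    forall y z, A y -> A z -> N y -> N z -> P y -> P z) ->
  forall x y, A x -> A y -> P x -> P y.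
Proof.
move=> Aconn Ploc x y Ax Ay Px.
suff AP : A `&` [set z | P z] = A by move: Ay; rewrite -AP => -[].
apply: Aconn; first by exists x.
- exists (interior [set z | A z -> P z]); first exact: open_interior.
  apply/seteqP; split=> z [Az]; last first.
    by move=> /nbhs_singleton Pz; split=> //; exact: Pz.
  move=> Pz; split=> //; have [N Nz NP] := Ploc z Az.
  apply: (filterS _ Nz) => w Nw Aw.
  by apply: (NP z) => //; exact: nbhs_singleton Nz.
- exists (~` interior [set z | A z -> ~ P z]).
    exact/open_closedC/open_interior.
  apply/seteqP; split=> z [Az].
    by move=> Pz; split=> // /nbhs_singleton/= /(_ Az).
  move=> nPz; split=> //; apply: contrapT => Pz; apply: nPz.
  have [N Nz NP] := Ploc z Az; apply: (filterS _ Nz) => w Nw Aw Pw.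
  by apply: Pz; apply: (NP w) => //; exact: nbhs_singleton Nz.
Qed.

Lemma connected_set_type (T : topologicalType) (A : set T) :
  connected A -> connected [set: A].
Proof.
move=> Aconn D [x Dx] [C [O oO OC] DC] [C' cC' DC'].
move: cC'; rewrite -openC => -[F oF FC'].
have DO z : D z <-> O (set_val z) by rewrite DC setTI -OC.
have DF z : D z <-> ~ F (set_val z).
  rewrite DC' setTI -[C']setCK -FC'; by [].
have AO : A `&` O = A.
  apply: Aconn; first by exists (set_val x); split; [exact: set_valP|exact/DO].
    by exists O.
  exists (~` F); first exact: open_closedC.
  apply/seteqP; split=> z [Az].
    move=> Oz; split=> //.
    by have /DF := (DO (exist _ z (mem_set Az))).2 Oz.
  move=> Fz; split=> //.
  by have /DO := (DF (exist _ z (mem_set Az))).2 Fz.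
apply/seteqP; split=> // z _; apply/DO.
by have := set_valP z; rewrite -{1}AO => -[].
Qed.

Lemma continuous_within_comp (S T U : topologicalType) (A : set T)
    (f : T -> U) (u : S -> T) :
  {within A, continuous f} -> continuous u -> (forall s, A (u s)) ->
  continuous (f \o u).
Proof.
move=> /subspace_continuousP cf cu Au s W /= /(cf _ (Au s)) Wf.
have : nbhs s (u @^-1` [set w | A w -> W (f w)]) := cu s _ Wf.
by apply: filterS => r; apply.
Qed.

Lemma continuous_compT (S T U : topologicalType) (u : S -> T) (f : T -> U) :
  continuous u -> continuous f -> continuous (f \o u).
Proof. by move=> cu cf s; apply: continuous_comp; [exact: cu|exact: cf]. Qed.

Lemma continuous_pair (S T U : topologicalType) (u : S -> T) (v : S -> U) :
  continuous u -> continuous v -> continuous (fun s => (u s, v s)).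
Proof.
move=> cu cv s W [[P Q] [/= Pu Qv] PQ].
have Pus : nbhs s (u @^-1` P) by exact: cu.
have Qvs : nbhs s (v @^-1` Q) by exact: cv.
by apply: filterS2 Pus Qvs => r Pr Qr; exact: PQ.
Qed.

(** Precomposing with the retraction [clamp] of the line onto the unit interval
    turns a map continuous within the interval into a globally continuous map.
    Paths and homotopies are handled in that form, so that their continuity
    need not be stated within a subset. *)
Section Clamp.
Context {R : realType}.
Implicit Types (s t : R).

Definition clamp t : R := Num.max 0 (Num.min t 1).

Lemma clamp_itv t : clamp t \in `[0, 1].
Proof.
rewrite in_itv/= /clamp le_max lexx/= ge_max ler01/=.
by rewrite ge_min lexx orbT.
Qed.

Lemma clamp_id t : t \in `[0, 1] -> clamp t = t.
Proof.
by rewrite in_itv/= /clamp => /andP[t0 t1]; rewrite min_l// max_r.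
Qed.

Lemma clampK t : clamp (clamp t) = clamp t.
Proof. exact/clamp_id/clamp_itv. Qed.

Lemma clamp_le0 t : t <= 0 -> clamp t = 0.
Proof. by move=> t0; rewrite /clamp max_l// ge_min t0. Qed.

Lemma clamp_ge1 t : 1 <= t -> clamp t = 1.
Proof. by move=> t1; rewrite /clamp min_r// max_r. Qed.

Lemma continuous_clamp : continuous clamp.
Proof.
move=> t.
have -> : clamp = (cst 0 : R -> R^o) \max ((id : R -> R^o) \min cst 1) by [].
apply: (@continuous_max R R); first exact: cvg_cst.
by apply: (@continuous_min R R); [exact: cvg_id|exact: cvg_cst].
Qed.

End Clamp.

Section Glue.
Context (R : realType) (T : topologicalType).

Lemma continuous_glue (f g : R -> T) (c : R) :
  continuous f -> continuous g -> f c = g c ->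
  continuous (fun t => if t <= c then f t else g t).
Proof.
move=> cf cg fgc t; rewrite /continuous_at; have [tc|ct|->] := ltgtP t c.
- apply: cvg_trans (cf t); apply: near_eq_cvg.
  by have := lt_nbhsl tc; apply: filterS => s /ltW ->.
- apply: cvg_trans (cg t); apply: near_eq_cvg.
  by have := lt_nbhsr ct; apply: filterS => s; rewrite ltNge => /negbTE ->.
- move=> W /= Wc.
  have Wf : nbhs c (f @^-1` W) by exact: cf.
  have Wg : nbhs c (g @^-1` W) by apply: cg; rewrite -fgc.
  by apply: filterS2 Wf Wg => s /= ? ?; case: ifP.
Qed.

End Glue.

Lemma connected_image (T U : topologicalType) (f : T -> U) (A : set T) :
  continuous f -> connected A -> connected (f @` A).
Proof.
move=> cf /connected_continuous_connected; apply.
exact: continuous_subspaceT.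
Qed.

Lemma ball_connected (R : realType) (t e : R) : connected (ball t e).
Proof. by rewrite ball_itv; exact/connected_intervalP/interval_is_interval. Qed.

(** * Lifting along a covering *)

Section Sheets.
Context (X Z : topologicalType) (q : X -> Z).

(** The part [V] of the preimage of an evenly covered open set [O], with the
    section [sigma] that inverts [q] on it. The second clause expresses that
    [V] is clopen in the preimage of [O], in the form in which lifting
    arguments use it. The section is total, with arbitrary values outside [O],
    hence the pointwise continuity. *)
Definition sheet (O : set Z) (V : set X) (sigma : Z -> X) : Prop :=
  [/\ open V,
      forall E, connected E -> E `<=` q @^-1` O -> E `&` V !=set0 -> E `<=` V,
      forall z, O z -> q (sigma z) = z,
      forall x, V x -> sigma (q x) = x &
      forall z, O z -> {for z, continuous sigma}].

Lemma covering_sheet : covering q -> forall z0, exists2 O, open_nbhs z0 O &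
  forall x, O (q x) -> exists V sigma, V x /\ sheet O V sigma.
Proof.
move=> [cq cov] z0; have [O Oz0 [F [Ftriv FO Fsheet]]] := cov z0.
exists O => // x Oqx.
have [V FV Vx] : (\bigcup_(V in F) V) x by rewrite FO.
have [oV [Vmaps Vinj Vsurj] Vopen] := Fsheet _ FV.
pose sigma z := xget x [set x' | V x' /\ q x' = z].
have sigmaP z : O z -> V (sigma z) /\ q (sigma z) = z.
  move=> Oz; rewrite /sigma; case: xgetP => [y _ //|noV].
  by have [y Vy qy] := Vsurj _ Oz; case: (noV y).
exists V, sigma; split=> //; split=> //.
- move=> E Econn EO [y [Ey Vy]].
  suff EV : E `&` V = E by rewrite -EV => w [].
  apply: Econn; [by exists y|by exists V|].
  (* The other members of the partition are open, so V is relatively closed. *)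
  exists (~` \bigcup_(W in F `\ V) W).
    apply: open_closedC; apply: bigcup_open => W [FW _].
    by have [] := Fsheet _ FW.
  apply/seteqP; split=> w [Ew].
    move=> Vw; split=> // -[W [FW WV] Ww]; apply: WV.
    by apply: Ftriv => //; exists w.
  move=> notW; split=> //.
  have [W FW Ww] : (\bigcup_(V in F) V) w by rewrite FO; exact: EO.
  have [<-//|WV] := pselect (W = V).
  by exfalso; apply: notW; exists W.
- by move=> z /sigmaP[].
- move=> y Vy; have Oqy := Vmaps _ Vy.
  by have [Vs qs] := sigmaP _ Oqy; apply: Vinj; rewrite ?inE.
- move=> z Oz W /=; rewrite nbhsE => -[W' [oW' W's] W'W].
  have [Vs qs] := sigmaP _ Oz.
  have oqW : open (q @` (W' `&` V)) by apply: Vopen => [|? []//]; exact: openI.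
  apply: (@filterS _ _ _ (q @` (W' `&` V))); last first.
    by apply: open_nbhs_nbhs; split=> //; exists (sigma z).
  move=> _ [y [W'y Vy] <-]; apply: W'W.
  have [Vsy qsy] := sigmaP _ (Vmaps _ Vy).
  by rewrite (_ : sigma (q y) = y)//; apply: Vinj; rewrite ?inE.
Qed.

Hypothesis qcov : covering q.

(** Fibres of a covering may be empty, but whether a fibre is empty does not
    change within an evenly covered set. *)
Lemma covering_surjective : [set: X] !=set0 -> connected [set: Z] ->
  forall z, exists x, q x = z.
Proof.
move=> [x _] Zconn z.
apply: (@connected_locally_constant _ _ (fun z => exists x, q x = z) Zconn)
  (I : setT (q x)) _ _ => //; last by exists x.
move=> z0 _; have [O Oz0 Osheet] := covering_sheet qcov z0.
exists O; first exact: open_nbhs_nbhs.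
move=> z1 z2 _ _ Oz1 Oz2 [x1 qx1].
have [|V [sigma [_ [_ _ qs _ _]]]] := Osheet x1; first by rewrite qx1.
by exists (sigma z2); exact: qs.
Qed.

Context (R : realType).

(** Two lifts that agree at one point near [t0] run in the same sheet near [t0],
    hence both are the image of the projected path by the same section. *)
Lemma lift_unique (g g' : R -> X) (t : R) :
  continuous g -> continuous g' -> q \o g =1 q \o g' -> g 0 = g' 0 ->
  g t = g' t.
Proof.
move=> cg cg' qgg' g0.
have Rconn : connected [set: R] by apply/connected_intervalP.
apply: (@connected_locally_constant _ _ (fun t => g t = g' t) Rconn)
  (I : setT (0 : R)) _ _ => // t0 _.
have [O [oO Ot0] Osheet] := covering_sheet qcov (q (g t0)).
have [V [sigma [Vt0 [_ EV _ sq _]]]] := Osheet _ Ot0.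
have : nbhs t0 ((q \o g) @^-1` O).
  apply: (continuous_comp (cg t0) (qcov.1 _)); exact: open_nbhs_nbhs.
move/nbhs_ballP => [e /= e0 eO]; exists (ball t0 e); first exact: nbhsx_ballx.
move=> t1 t2 _ _ et1 et2 g1.
have gV : g @` ball t0 e `<=` V.
  apply: EV; first exact/connected_image/ball_connected.
    by move=> _ [s /eO ? <-].
  by exists (g t0); split=> //; exists t0 => //; exact: ballxx.
have g'V : g' @` ball t0 e `<=` V.
  apply: EV; first exact/connected_image/ball_connected.
    by move=> _ [s /eO + <-]; rewrite /preimage/= -[q (g s)]/((q \o g) s) qgg'.
  exists (g' t1); split; first by exists t1.
  by rewrite -g1; apply: gV; exists t1.
rewrite -[LHS]sq; last by apply: gV; exists t2.
rewrite -[RHS]sq; last by apply: g'V; exists t2.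
by congr sigma; exact: qgg'.
Qed.

(** The continuity needed for homotopy lifting, for a family [G s] of path lifts
    already chosen separately for each [s]. For a fixed parameter [s0],
    continuity in [s] at [s0] is a locally constant property of [t]: if it holds
    at one time, then for [s] near [s0] the path [G s] stays, during a short
    interval of time, in the sheet of [G s0], where it is given by a continuous
    section. *)
Lemma lift_parametric (H : R * R -> Z) (G : R -> R -> X) (t : R) :
  continuous H -> (forall s, continuous (G s)) ->
  (forall s t, q (G s t) = H (s, t)) -> continuous (G ^~ 0) ->
  continuous (G ^~ t).
Proof.
move=> cH cG qG cG0 s0.
have Rconn : connected [set: R] by apply/connected_intervalP.
apply: (@connected_locally_constant _ _
  (fun t => {for s0, continuous (G ^~ t)}) Rconn) (I : setT (0 : R)) _ _ => //;
  last exact: cG0.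
move=> t0 _.
have [O [oO Ot0] Osheet] := covering_sheet qcov (H (s0, t0)).
rewrite -qG in Ot0.
have [V [sigma [Vt0 [oV EV _ sq csigma]]]] := Osheet _ Ot0.
rewrite qG in Ot0.
have : nbhs (s0, t0) (H @^-1` O) by apply: cH; exact: open_nbhs_nbhs.
move=> [[M N] /= [Ms0 /nbhs_ballP[e /= e0 eN]] MNO].
exists (ball t0 e); first exact: nbhsx_ballx.
have inV s t1 : M s -> ball t0 e t1 -> V (G s t1) ->
    forall t2, ball t0 e t2 -> V (G s t2).
  move=> Ms et1 Vst1 t2 et2.
  apply: (EV (G s @` ball t0 e)); last by exists t2.
  - exact/connected_image/ball_connected.
  - by move=> _ [r /eN Nr <-] /=; rewrite qG; apply: MNO.
  - by exists (G s t1); split=> //; exists t1.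
move=> t1 t2 _ _ et1 et2 ct1.
have Vs0 := inV s0 t0 (nbhs_singleton Ms0) (ballxx _ e0) Vt0.
(* Near s0, the path value is the image of a continuous map by the section. *)
have near_sigma : \forall s \near s0, sigma (H (s, t2)) = G s t2.
  have : nbhs s0 ((G ^~ t1) @^-1` V).
    by apply: ct1; apply: open_nbhs_nbhs; split=> //; exact: Vs0.
  move: Ms0; apply: filterS2 => s Ms Vs.
  by rewrite -qG sq//; exact: inV Vs _ et2.
have s0E : sigma (H (s0, t2)) = G s0 t2 := nbhs_singleton near_sigma.
apply: cvg_trans; first exact: near_eq_cvg near_sigma.
change (sigma (H (s, t2)) @[s --> s0] --> G s0 t2); rewrite -s0E.
have OH : O (H (s0, t2)).
  by apply: MNO; split=> /=; [exact: nbhs_singleton|exact: eN].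
apply: (@continuous_comp _ _ _ (fun s => H (s, t2)) sigma); last exact: csigma.
apply: (@continuous_comp _ _ _ (fun s => (s, t2)) H); last exact: cH.
by apply: continuous_pair => r; [exact: cvg_id|exact: cvg_cst].
Qed.

(** Being liftable up to time [t] is locally constant in [t]. A lift up to
    time [t] is encoded as a globally continuous lift of the path stopped at
    time [t]; prolonging it within an evenly covered set means following the
    local section from the sheet that has been reached. *)
Lemma path_lifting (f : R -> Z) (x0 : X) : continuous f -> q x0 = f 0 ->
  exists g : R -> X,
    [/\ continuous g, g 0 = x0 & forall t, q (g t) = f (clamp t)].
Proof.
move=> cf qx0.
pose f' t := f (Num.max 0 t).
have cf' : continuous f'.
  apply: (@continuous_compT R R Z (Num.max (0:R)) f) => // t.
  by apply: (@continuous_max R R (cst 0) id); [exact: cvg_cst|exact: cvg_id].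
have cmin (t : R) : continuous (Num.min^~ t).
  move=> s; apply: (@continuous_min R R id (cst t)).
    exact: cvg_id.
  exact: cvg_cst.
pose P t := exists g : R -> X,
    [/\ continuous g, g 0 = x0 & forall s, q (g s) = f' (Num.min s t)].
suff : P 1 by [].
apply: (@connected_locally_constant _ _ P (@segment_connected R 0 1) _ 0);
  rewrite /= ?in_itv/= ?lexx ?ler01//; last first.
  exists (cst x0); split=> //; first by move=> ?; exact: cvg_cst.
  by move=> s; rewrite qx0 /f' max_l// ge_min lexx orbT.
move=> t0 _; have [O [oO Ot0] Osheet] := covering_sheet qcov (f' t0).
have : nbhs t0 (f' @^-1` O) by apply: cf'; exact: open_nbhs_nbhs.
move/nbhs_ballP => [e /= e0 eO]; exists (ball t0 e); first exact: nbhsx_ballx.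
move=> t1 t2; rewrite /= !in_itv/= => /andP[t1ge0 _] /andP[t2ge0 _] et1 et2.
move=> [g [cg g0 qg]]; have [t21|t12] := leP t2 t1.
  exists (fun s => g (Num.min s t2)); split.
  - exact: (@continuous_compT _ _ _ (Num.min^~ t2) g).
  - by rewrite min_l.
  - by move=> s; rewrite qg -minA (min_l t21).
have Ogt1 : O (q (g t1)) by rewrite qg minxx; exact: eO.
have [V [sigma [Vt1 [oV EV qsigma sq csigma]]]] := Osheet _ Ogt1.
pose h s := sigma (f' (Num.min s t2)).
have eh s : t1 <= s -> ball t0 e (Num.min s t2).
  move: et1 et2; rewrite !ball_itv/= !in_itv/= => /andP[? ?] /andP[? ?] ?.
  by rewrite lt_min gt_min; lra.
exists (fun s => if s <= t1 then g s else h s); split.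
- move=> s; have [st1|t1s] := ltP s t1.
    rewrite /continuous_at/= (ltW st1).
    apply: cvg_trans (cg s); apply: near_eq_cvg.
    by have := lt_nbhsl st1; apply: filterS => r /ltW ->.
  (* To the right of t1 the glued map is the section; at t1 itself it also
     agrees with the section on the left, because g is already in the sheet. *)
  have near_h : \forall r \near s, h r = if r <= t1 then g r else h r.
    move: t1s; rewrite le_eqVlt => /predU1P[<-|t1s].
      have : nbhs t1 (g @^-1` V) by apply: cg; exact: open_nbhs_nbhs.
      apply: filterS => r /= Vr; case: ifPn => // rt1.
      rewrite -[RHS]sq// qg /h; congr (sigma (f' _)).
      by rewrite !min_l// (le_trans rt1)// ltW.
    have := lt_nbhsr t1s; apply: filterS => r.
    by rewrite /= ltNge => /negbTE ->.
  rewrite /continuous_at -(nbhs_singleton near_h).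
  apply: cvg_trans; first exact: near_eq_cvg near_h.
  apply: (@continuous_comp _ _ _ (fun s => f' (Num.min s t2)) sigma);
    last exact/csigma/eO/eh.
  exact: (@continuous_compT _ _ _ (Num.min^~ t2) f').
- by rewrite t1ge0.
- move=> s; case: ifPn => [st1|]; rewrite -?ltNge.
    by rewrite qg !min_l// (le_trans st1)// ltW.
  by move=> /ltW/eh/eO/qsigma.
Qed.

End Sheets.

(** * Homotopies and simple connectedness *)

Lemma continuous_clamp_square (R : realType) (X : topologicalType)
    (H : R * R -> X) :
  {within `[0, 1]%classic `*` `[0, 1]%classic, continuous H} ->
  continuous (fun z => H (clamp z.1, clamp z.2)).
Proof.
move=> cH; have clampC : continuous (@clamp R) by exact: continuous_clamp.
apply: (continuous_within_comp cH (u := fun z => (clamp z.1, clamp z.2))).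
  apply: continuous_pair; apply: continuous_compT => // z.
    exact: cvg_fst.
  exact: cvg_snd.
by move=> z; split; exact: clamp_itv.
Qed.

Section ContinuousPaths.
Context (R : realType) (X : topologicalType).

Lemma path_connected_continuous (A : set X) x y :
  path_connected R A -> A x -> A y -> exists f : R -> X,
    [/\ continuous f, f 0 = x, f 1 = y & forall t, A (f t)].
Proof.
move=> Apath Ax Ay; have [f [cf f0 f1] fA] := Apath _ _ Ax Ay.
exists (f \o clamp); split=> /=.
- apply: continuous_within_comp cf _ _; first exact: continuous_clamp.
  by move=> s; exact: clamp_itv.
- by rewrite clamp_le0.
- by rewrite clamp_ge1.
- by move=> t; apply: fA; exists (clamp t) => //; exact: clamp_itv.
Qed.

Lemma open_connected_path (A : set X) x y :
  locally_path_connected R X -> open A -> connected A -> A x -> A y ->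
  exists f : R -> X,
    [/\ continuous f, f 0 = x, f 1 = y & forall t, A (f t)].
Proof.
move=> Xlpc oA Aconn Ax Ay.
apply: (@connected_locally_constant _ _ (fun y => exists f : R -> X,
    [/\ continuous f, f 0 = x, f 1 = y & forall t, A (f t)])
    Aconn _ x y Ax Ay); last first.
  by exists (cst x); split=> // z; exact: cvg_cst.
move=> z Az; have [U [Uz Upath UA]] := Xlpc z A (open_nbhs_nbhs (conj oA Az)).
exists U; first exact: (open_nbhs_nbhs Uz).
move=> y1 y2 _ _ Uy1 Uy2 [f [cf f0 f1 fA]].
have [h [ch h0 h1 hU]] := path_connected_continuous Upath Uy1 Uy2.
exists (fun t => if t <= 2^-1 then f (2 * t) else h (2 * t - 1)); split.
- apply: continuous_glue.
  + apply: (@continuous_compT R R X ( *%R 2) f) => // t.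
    exact: mulrl_continuous.
  + apply: (@continuous_compT R R X (fun t => 2 * t - 1) h) => // t.
    by apply: cvgB; [exact: mulrl_continuous|exact: cvg_cst].
  + have -> : 2 * 2^-1 = 1 :> R by lra.
    by rewrite f1 subrr h0.
- by rewrite invr_ge0 ler0n mulr0.
- rewrite ifF; last by apply/negbTE; rewrite -ltNge; lra.
  by rewrite (_ : 2 * 1 - 1 = 1)//; lra.
- by move=> t; case: ifP => _ //; exact/UA.
Qed.

(** The paths [g], [e] and the reverse of [g'] form a loop [l]. Its
    null-homotopy [H], prolonged by [clamp], is a map on the plane that is [l]
    on the side [s = 0] of the unit square and constant beyond the other three
    sides. The required square is [H] precomposed with a map [Phi] of the square
    into the plane: [Phi] sends three sides of the square to the thirds of the
    side [s = 0], and the side [t = 0] to a path around the three sides on which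
    [H] is constant. [Phi] interpolates linearly from [t = 0] to [t = 1]. *)
Lemma simply_connected_square (g g' e : R -> X) :
  simply_connected R X -> continuous g -> continuous g' -> continuous e ->
  g 0 = g' 0 -> g 1 = e 0 -> g' 1 = e 1 ->
  exists K : R * R -> X, [/\ continuous K,
    forall t, t \in `[0, 1] -> K (0, t) = g t,
    forall t, t \in `[0, 1] -> K (1, t) = g' t,
    forall s, s \in `[0, 1] -> K (s, 0) = g 0 &
    forall s, s \in `[0, 1] -> K (s, 1) = e s].
Proof.
move=> [_ _ Xsc] cg cg' ce gg'0 ge g'e.
have caff (a b : R) : continuous (fun t : R => a * t + b).
  by move=> t; apply: cvgD; [exact: mulrl_continuous|exact: cvg_cst].
pose l u := if u <= 3^-1 then g (3 * u + 0) else
  if u <= 2 * 3^-1 then e (3 * u + -1) else g' (- 3 * u + 3).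
have cl : continuous l.
  apply: continuous_glue.
  - exact: (@continuous_compT R R X (fun t => 3 * t + 0) g).
  - apply: continuous_glue.
    + exact: (@continuous_compT R R X (fun t => 3 * t + -1) e).
    + exact: (@continuous_compT R R X (fun t => - 3 * t + 3) g').
    + rewrite (_ : 3 * (2 * 3^-1) + -1 = 1); last by lra.
      by rewrite (_ : - 3 * (2 * 3^-1) + 3 = 1)//; lra.
  - rewrite ifT; last by lra.
    rewrite (_ : 3 * 3^-1 + 0 = 1); last by lra.
    by rewrite (_ : 3 * 3^-1 + -1 = 0)//; lra.
have lg (t : R) : 0 <= t -> t <= 1 -> l (t / 3) = g t.
  move=> t0 t1; rewrite /l ifT; last by lra.
  by congr g; lra.
have le (s : R) : 0 <= s -> s <= 1 -> l ((1 + s) / 3) = e s.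
  move=> s0 s1; rewrite /l; have [sle0|sgt0] := leP ((1 + s) / 3) 3^-1.
    have -> : s = 0 by lra.
    by rewrite -ge; congr g; lra.
  rewrite ifT; last by lra.
  by congr e; lra.
have lg' (t : R) : 0 <= t -> t <= 1 -> l (1 - t / 3) = g' t.
  move=> t0 t1; rewrite /l ifF; last by apply/negbTE; rewrite -ltNge; lra.
  have [tge1|tlt1] := leP (1 - t / 3) (2 * 3^-1).
    have -> : t = 1 by lra.
    by rewrite g'e; congr e; lra.
  by congr g'; lra.
have l0 : l 0 = g 0 by rewrite -(lg 0)// mul0r.
have l1 : l 1 = g 0 by rewrite gg'0 -(lg' 0)// mul0r subr0.
have loop : path_to R (g 0) [set g 0] l.
  by split=> //; exact: continuous_subspaceT.
have [H [cH H0 H1 Hs]] := Xsc _ _ loop.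
pose H' z := H (clamp z.1, clamp z.2).
have cH' : continuous H' by exact: continuous_clamp_square.
have H'l u : 0 <= u -> u <= 1 -> H' (0, u) = l u.
  move=> u0 u1; rewrite /H'/= (clamp_le0 (lexx 0)) H0 ?clamp_itv//.
  by rewrite clamp_id// in_itv/= u0.
have H'1 s u : 1 <= s -> H' (s, u) = g 0.
  by move=> s1; rewrite /H'/= clamp_ge1// H1 ?clamp_itv.
have H's0 s u : u <= 0 -> H' (s, u) = g 0.
  by move=> u0; rewrite /H'/= (clamp_le0 u0); have [] := Hs _ (clamp_itv s).
have H's1 s u : 1 <= u -> H' (s, u) = g 0.
  by move=> u1; rewrite /H'/= (clamp_ge1 u1); have [_ ->] := Hs _ (clamp_itv s).
(* 9/2 s (1 - s) is at least 1 on [1/3, 2/3], exactly where the clamped second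
   coordinate leaves its end values 0 and 1. *)
pose Phi (z : R * R) := ((1 - z.2) * (9 / 2 * (z.1 * (1 - z.1))),
  (1 - z.2) * clamp (3 * z.1 + -1) + z.2 * ((1 + z.1) / 3)).
have cfst : continuous (fun z : R * R => z.1) by move=> z; exact: cvg_fst.
have csnd : continuous (fun z : R * R => z.2) by move=> z; exact: cvg_snd.
have c1snd : continuous (fun z : R * R => 1 - z.2).
  by move=> z; apply: cvgB; [exact: cvg_cst|exact: csnd].
have cclamp : continuous (fun z : R * R => clamp (3 * z.1 + -1)).
  apply: (@continuous_compT _ R R (fun z : R * R => 3 * z.1 + -1) clamp).
    exact: (@continuous_compT _ R R (fun z : R * R => z.1)
      (fun t => 3 * t + -1)).
  exact: continuous_clamp.
have cPhi : continuous Phi.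
  apply: continuous_pair => z.
    apply: cvgM; first exact: c1snd.
    apply: cvgM; first exact: cvg_cst.
    apply: cvgM; first exact: cfst.
    by apply: cvgB; [exact: cvg_cst|exact: cfst].
  apply: cvgD.
    apply: cvgM; first exact: c1snd.
    exact: cclamp.
  apply: cvgM; first exact: csnd.
  apply: cvgM; last exact: cvg_cst.
  by apply: cvgD; [exact: cvg_cst|exact: cfst].
exists (H' \o Phi); split=> [|t|t|s|s]; rewrite ?in_itv/=.
- exact: continuous_compT.
- move=> /andP[t0 t1]; rewrite /Phi/= clamp_le0; last by lra.
  rewrite -(lg t)// -H'l; [|lra|lra].
  by congr (H' (_, _)); lra.
- move=> /andP[t0 t1]; rewrite /Phi/= clamp_ge1; last by lra.
  rewrite -(lg' t)// -H'l; [|lra|lra].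
  by congr (H' (_, _)); lra.
- move=> /andP[s0 s1]; rewrite /Phi/=.
  have [s13|s13] := leP s (1 / 3).
    rewrite clamp_le0; last by lra.
    by apply: H's0; lra.
  have [s23|s23] := leP (2 / 3) s.
    rewrite clamp_ge1; last by lra.
    by apply: H's1; lra.
  by apply: H'1; nra.
- move=> /andP[s0 s1]; rewrite -(le s)// -H'l; [|lra|lra].
  by rewrite /Phi/=; congr (H' (_, _)); lra.
Qed.

End ContinuousPaths.

Section CoveringHomotopy.
Context (R : realType) (X Z : topologicalType) (q : X -> Z).
Hypothesis qcov : covering q.

(** The ends of the lifts of a homotopy form a connected set, which lies over
    the set where the homotopy has its free end. *)
Lemma homotopic_lifts_connected (W : set Z) (g0 g1 : R -> X) :
  continuous g0 -> continuous g1 -> g0 0 = g1 0 ->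
  homotopic_to (q (g0 0)) W (q \o g0) (q \o g1) ->
  exists E, [/\ connected E, E `<=` q @^-1` W, E (g0 1) & E (g1 1)].
Proof.
move=> cg0 cg1 g01 [H [cH H0 H1 Hs]].
have clampC : continuous (@clamp R) by exact: continuous_clamp.
pose H' z := H (clamp z.1, clamp z.2).
have cH' : continuous H' by exact: continuous_clamp_square.
have /choice[G GP] s : exists G : R -> X,
    [/\ continuous G, G 0 = g0 0 & forall t, q (G t) = H' (s, t)].
  have [| |G [cG G0 qG]] :=
    @path_lifting _ _ _ qcov R (fun t => H' (s, t)) (g0 0).
  - apply: (@continuous_compT _ _ _ (fun t => (s, t)) H') => //.
    by apply: continuous_pair => t; [exact: cvg_cst|exact: cvg_id].
  - by rewrite /H'/= (clamp_le0 (lexx 0)); have [-> _] := Hs _ (clamp_itv s).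
  - by exists G; split=> // t; rewrite qG /H'/= clampK.
have GE s (g : R -> X) : continuous g -> g 0 = g0 0 ->
    (forall t, t \in `[0, 1] -> H (clamp s, t) = q (g t)) -> G s 1 = g 1.
  move=> cg gg0 Hg; have [cG G0 qG] := GP s.
  rewrite (@lift_unique _ _ _ qcov _ (G s) (g \o clamp) 1) //=.
  - by rewrite clamp_ge1.
  - exact: continuous_compT.
  - by move=> t; rewrite /= qG /H'/= Hg// clamp_itv.
  - by rewrite clamp_le0// gg0.
exists (range (G ^~ 1)); split.
- apply: connected_image; last exact/connected_intervalP.
  apply: (lift_parametric qcov cH') => [s|s t|]; try by have [] := GP s.
  rewrite (_ : G ^~ 0 = cst (g0 0)); first by move=> s; exact: cvg_cst.
  by apply/funext => s; have [] := GP s.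
- move=> _ [s _ <-] /=; have [_ _ ->] := GP s.
  by rewrite /H'/= (clamp_ge1 (lexx 1)); have [] := Hs _ (clamp_itv s).
- exists 0 => //; apply: GE => // t t01; rewrite (clamp_le0 (lexx 0)).
  exact: H0.
- exists 1 => //; apply: GE => // t t01; rewrite (clamp_ge1 (lexx 1)).
  exact: H1.
Qed.

(** A path in [E] between the ends of the lifts fills, by simple connectedness,
    to a square whose projection is a homotopy; its free end runs along the
    projection of [E]. *)
Lemma homotopic_of_lifts (W : set Z) (g0 g1 : R -> X) (E : set X) :
  simply_connected R X -> locally_path_connected R X ->
  continuous g0 -> continuous g1 -> g0 0 = g1 0 ->
  open E -> connected E -> E `<=` q @^-1` W -> E (g0 1) -> E (g1 1) ->
  homotopic_to (q (g0 0)) W (q \o g0) (q \o g1).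
Proof.
move=> Xsc Xlpc cg0 cg1 g01 oE Econn EW Eg0 Eg1.
have [e [ce e0 e1 eE]] := open_connected_path Xlpc oE Econn Eg0 Eg1.
have [K [cK K0 K1 Ks0 Ks1]] :=
  simply_connected_square Xsc cg0 cg1 ce g01 (esym e0) (esym e1).
exists (q \o K); split=> [|t t01|t t01|s s01] /=.
- by apply/continuous_subspaceT/continuous_compT => //; exact: qcov.1.
- by rewrite K0.
- by rewrite K1.
- by rewrite Ks0// Ks1//; split=> //; exact/EW.
Qed.

End CoveringHomotopy.

(** * Components, subspaces and products of discrete spaces *)

Lemma is_componentE (T : topologicalType) (A C : set T) x :
  is_component A C -> C x -> C = connected_component A x.
Proof. by move=> [y Ay ->] /same_connected_component. Qed.

Lemma is_component_eq (T : topologicalType) (A C D : set T) x :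
  is_component A C -> is_component A D -> C x -> D x -> C = D.
Proof. by move=> compA AD /(is_componentE compA)-> /(is_componentE AD)->. Qed.

Lemma is_component_mem (T : topologicalType) (A : set T) x :
  A x -> is_component A (connected_component A x).
Proof. by move=> Ax; exists x. Qed.

Lemma is_component_nonempty (T : topologicalType) (A C : set T) :
  is_component A C -> C !=set0.
Proof. by move=> [x Ax ->]; exists x; exact: connected_component_refl. Qed.

Lemma is_component_sub (T : topologicalType) (A C : set T) :
  is_component A C -> C `<=` A.
Proof. by move=> [x Ax ->]; exact: connected_component_sub. Qed.

Lemma is_component_connected (T : topologicalType) (A C : set T) :
  is_component A C -> connected C.
Proof. by move=> [x Ax ->]; exact: component_connected. Qed.

Lemma is_component_max (T : topologicalType) (A C E : set T) x :
  is_component A C -> C x -> E x -> E `<=` A -> connected E -> E `<=` C.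
Proof.
move=> compA Cx Ex EA Econn; rewrite (is_componentE compA Cx).
exact: connected_component_max.
Qed.

Lemma is_component_mono (T : topologicalType) (A A' C C' : set T) x :
  is_component A C -> is_component A' C' -> C x -> C' x -> A `<=` A' ->
  C `<=` C'.
Proof.
move=> compA compA' Cx C'x AA'; apply: is_component_max compA' C'x Cx _ _.
  by apply: subset_trans AA'; exact: is_component_sub.
exact: is_component_connected compA.
Qed.

Lemma continuous_set_type (T X : topologicalType) (A : set X) (f : T -> A) :
  continuous (set_val \o f) -> continuous f.
Proof.
move=> cf t W /=; rewrite nbhsE => -[_ [[O oO <-] Ot] OW].
have : nbhs t ((set_val \o f) @^-1` O) by apply: cf; exact: open_nbhs_nbhs.
by apply: filterS => s Os; exact: OW.
Qed.

Lemma continuous_prod_discrete (S : topologicalType) (I : Type)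
    (T : I -> choiceType)
    (f : S -> prod_topology (fun i => discrete_topology (T i))) :
  (forall s i, \forall r \near s, f r i = f s i) -> continuous f.
Proof.
move=> floc s; apply/cvg_sup => i W [_ [[O oO <-] Oi] OW] /=.
by apply: filterS (floc s i) => r fr; apply: OW; rewrite /= fr.
Qed.

Lemma prod_discrete_nbhs (I : Type) (T : I -> choiceType)
    (c : prod_topology (fun i => discrete_topology (T i))) (i : I) :
  nbhs c [set d | d i = c i].
Proof.
have cc : nbhs c --> c by [].
move/cvg_sup/(_ i): cc; apply; exists [set d | d i = c i] => //; split=> //.
by exists [set c i] => //; exact: discrete_open.
Qed.

(** * Fibres of complete spreads as limits of component sets *)

(** The sets [T U] index, through [comp], the connected components over the
    members [U] of the basis, and [phi] corresponds to the inclusion of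
    components. *)
Section FibreLimit.
Context (X Y : topologicalType) (p : X -> Y) (b : Y) (B : set (set Y)).
Hypotheses (pcs : complete_spread p) (Xhaus : hausdorff_space X)
  (Yhaus : hausdorff_space Y).
Hypotheses (Bbasis : connected_nbhs_basis b B) (bcl : closure (range p) b).
Context (T : B -> choiceType)
  (phi : forall U V : B, \val U `<=` \val V -> T U -> T V)
  (comp : forall U : B, T U -> set X).
Hypothesis compP : forall U c, is_component (p @^-1` \val U) (@comp U c).
Hypothesis comp_inj : forall U, injective (@comp U).
Hypothesis comp_surj : forall U C,
  is_component (p @^-1` \val U) C -> exists c, @comp U c = C.
Hypothesis comp_phi : forall U V (UV : \val U `<=` \val V) c,
  @comp U c `<=` comp (phi UV c).

Local Notation lim :=
  (projlim (I := B) (T := fun U => discrete_topology (T U)) phi).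

Lemma basis_open_nbhs (U : B) : open_nbhs b (\val U) /\ connected (\val U).
Proof. by have [BO _] := Bbasis; apply: BO; exact: set_valP. Qed.

Lemma basis_refine (W : set Y) : nbhs b W -> exists U : B, \val U `<=` W.
Proof.
have [_ Bb] := Bbasis; move=> /Bb[U BU UW].
by exists (exist _ U (mem_set BU)).
Qed.

Lemma comp_open (U : B) (c : T U) : open (comp c).
Proof.
have [[_ [po _]] _] := pcs; apply: po.
by exists (\val U); [have [[]] := basis_open_nbhs U|exact: compP].
Qed.

(** Components of preimages of arbitrary open sets form a basis, and each of
    them that contains a point over [b] contains a component over a member
    of [B]. *)
Lemma comp_small (c : forall U, T U) (x : X) (W : set X) : p x = b ->
  (forall U, comp (c U) x) -> nbhs x W -> exists U, comp (c U) `<=` W.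
Proof.
move=> pxb cx; have [[_ [po pbase]] _] := pcs.
move=> /(pbase x)[C [[O oO OC] Cx] CW].
have Ob : nbhs b O.
  apply: open_nbhs_nbhs; split=> //; rewrite -pxb.
  exact: (is_component_sub OC).
have [U UO] := basis_refine Ob; exists U; apply: subset_trans CW.
by apply: is_component_mono (compP _) OC (cx U) Cx _ => z; exact: UO.
Qed.

(** Completeness gives the point, but asks for a choice of components over all
    connected open neighbourhoods [W] of [b]: the component over [W] is the one
    that contains the given component over some member of [B] within [W]. Two
    members of [B] lead to the same component, as a third one lies in both. *)
Lemma fibre_point (c : lim) :
  exists x, p x = b /\ forall U, comp (set_val c U) x.
Proof.
have cphi U V (UV : \val U `<=` \val V) : phi UV (set_val c U) = set_val c V.
  exact: (set_valP c).
pose chi (W : set Y) := [set x | exists C, [/\ is_component (p @^-1` W) C,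
  C x & exists2 U : B, \val U `<=` W & comp (set_val c U) `<=` C]].
have chiE W C (U : B) : is_component (p @^-1` W) C -> \val U `<=` W ->
    comp (set_val c U) `<=` C -> chi W = C.
  move=> WC UW UC; apply/seteqP; split=> x; last first.
    by move=> Cx; exists C; split=> //; exists U.
  move=> [D [WD Dx [V VW VD]]].
  have [U' U'UV] : exists U' : B, \val U' `<=` \val U `&` \val V.
    apply: basis_refine; apply: filterI; apply: open_nbhs_nbhs;
      [exact: (basis_open_nbhs U).1|exact: (basis_open_nbhs V).1].
  have U'U : \val U' `<=` \val U by move=> z /U'UV[].
  have U'V : \val U' `<=` \val V by move=> z /U'UV[].
  have [y U'y] := is_component_nonempty (compP (set_val c U')).
  suff -> : C = D by [].
  apply: (is_component_eq WC WD (x := y)).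
    by apply: UC; rewrite -(cphi _ _ U'U); exact: comp_phi.
  by apply: VD; rewrite -(cphi _ _ U'V); exact: comp_phi.
have comp_above (U : B) W : \val U `<=` W -> exists2 C,
    is_component (p @^-1` W) C & comp (set_val c U) `<=` C.
  move=> UW; have [x Ux] := is_component_nonempty (compP (set_val c U)).
  have pUW : p @^-1` \val U `<=` p @^-1` W by move=> z; exact: UW.
  have Wx : (p @^-1` W) x by apply: pUW; exact: is_component_sub (compP _) _ Ux.
  exists (connected_component (p @^-1` W) x); first exact: is_component_mem.
  apply: is_component_mono (compP _) (is_component_mem Wx) Ux _ pUW.
  exact: connected_component_refl.
have [_ pcomp] := pcs.
have [W [Wb _]|V W [Vb _] _ VW|x xchi] := pcomp b chi bcl.
- have [U UW] := basis_refine (open_nbhs_nbhs Wb).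
  by have [C WC UC] := comp_above _ _ UW; rewrite (chiE W C U).
- have [U UV] := basis_refine (open_nbhs_nbhs Vb).
  have UW := subset_trans UV VW.
  have [C VC UC] := comp_above _ _ UV; have [D WD UD] := comp_above _ _ UW.
  rewrite (chiE V C U)// (chiE W D U)//.
  have [y Uy] := is_component_nonempty (compP (set_val c U)).
  by apply: is_component_mono VC WD (UC _ Uy) (UD _ Uy) _ => z; exact: VW.
have compx U : comp (set_val c U) x.
  suff <- : chi (\val U) = comp (set_val c U).
    exact: xchi (basis_open_nbhs U).
  by apply: (chiE _ _ U) => //; exact: compP.
exists x; split=> //; apply/esym/Yhaus => O O' /basis_refine[U UO] O'px.
exists (p x); split; last exact: nbhs_singleton.
exact/UO/(is_component_sub (compP _) (compx U)).
Qed.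

(** A point of the fibre corresponds to the family of the components that
    contain it. Both topologies have as basic neighbourhoods the sets of all
    points, respectively families, with a prescribed component over one [U]. *)
Lemma fibre_homeomorphic_projlim : homeomorphic (p @^-1` [set b] : set X) lim.
Proof.
have fibreU (x : p @^-1` [set b]) (U : B) : (p @^-1` \val U) (set_val x).
  by have /= -> := set_valP x; have [[]] := basis_open_nbhs U.
have /choice[g gP] (x : p @^-1` [set b]) :
    exists c : lim, forall U, comp (set_val c U) (set_val x).
  have cP U := cid (comp_surj (is_component_mem (fibreU x U))).
  pose c U : T U := projT1 (cP U).
  have cx U : comp (c U) (set_val x).
    by rewrite (projT2 (cP U)); exact/connected_component_refl/fibreU.
  suff limc : c \in lim by exists (exist _ c limc).
  rewrite inE => U V UV; apply: comp_inj.
  by apply: is_component_eq (compP _) (compP _) (comp_phi UV (cx U)) (cx V).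
have /choice[h hP] (c : lim) : exists x : p @^-1` [set b],
    forall U, comp (set_val c U) (set_val x).
  have [x [pxb cx]] := fibre_point c.
  have xb : x \in p @^-1` [set b] by rewrite inE.
  by exists (exist _ x xb).
have coord (x : p @^-1` [set b]) (c d : lim) U :
    comp (set_val c U) (set_val x) ->
    comp (set_val d U) (set_val x) -> set_val c U = set_val d U.
  by move=> cx dx; apply: comp_inj; exact: is_component_eq cx dx.
have fibre_inj (x y : p @^-1` [set b]) (c : lim) :
    (forall U, comp (set_val c U) (set_val x)) ->
    (forall U, comp (set_val c U) (set_val y)) -> x = y.
  move=> cx cy; apply: val_inj; apply: Xhaus => W W' xW yW'.
  have [U UW] := comp_small (set_valP x) cx xW.
  by exists (set_val y); split; [exact/UW/cy|exact: nbhs_singleton].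
exists g, h; split.
- apply: continuous_set_type; apply: continuous_prod_discrete => x U /=.
  have : nbhs x (set_val @^-1` comp (set_val (g x) U)).
    apply: initial_continuous; apply: open_nbhs_nbhs.
    by split; [exact: comp_open|exact: gP].
  by apply: filterS => y gxy; exact: coord (gP y U) gxy.
- apply: continuous_set_type => c W /= Wc.
  have [U UW] := comp_small (set_valP (h c)) (hP c) Wc.
  have : nbhs c (set_val @^-1` [set d | d U = set_val c U]).
    by apply: initial_continuous; exact: prod_discrete_nbhs.
  by apply: filterS => d /= dU; apply: UW; rewrite -dU; exact: hP.
- by move=> x; apply: fibre_inj (hP _) (gP _).
- move=> c; apply: val_inj; apply: functional_extensionality_dep => U.
  exact: coord (gP _ U) (hP _ U).
Qed.

End FibreLimit.

(** * Classes of paths as components of preimages *)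

Lemma embedding_preimage_connected (X X' : topologicalType) (j : X -> X')
    (A : set X') :
  embedding j -> connected A -> A `<=` range j -> connected (j @^-1` A).
Proof.
move=> [jinj jopen] Aconn Aj D [x Dx] [C oC DC] [F cF DF].
have [O oO CO] := (jopen C).1 oC.
have [O' oO' FO'] := (jopen (~` F)).1 (closed_openC cF).
have DO y : D y <-> A (j y) /\ O (j y) by rewrite DC CO.
have DO' y : D y <-> A (j y) /\ ~ O' (j y).
  by rewrite DF -[F]setCK FO'.
have AO : A `&` O = A.
  apply: Aconn; first by exists (j x); exact/DO.
    by exists O.
  exists (~` O'); first exact: open_closedC.
  apply/seteqP; split=> z [Az]; have [y _ yz] := Aj _ Az; subst z.
    by move=> Oy; exact/DO'/DO.
  by move=> Oy; exact/DO/DO'.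
apply/seteqP; split=> y; first by move=> /DO[].
by move=> Ay; apply/DO; move: (Ay); rewrite /preimage/= -{1}AO.
Qed.

Section PortlyEmbedding.
Context (X X' : topologicalType) (j : X -> X').
Hypotheses (jemb : embedding j) (jportly : portly (range j)).
Context (C : set X') (oC : open C) (Cconn : connected C).

Lemma portly_preimage_open : open (j @^-1` C).
Proof. by apply/(jemb.2 _).2; exists C. Qed.

Lemma portly_preimage_connected : connected (j @^-1` C).
Proof.
rewrite (_ : j @^-1` C = j @^-1` (C `&` range j)).
  have [_ _ jlc] := jportly.
  exact: embedding_preimage_connected jemb (jlc _ oC Cconn) (@subIsetr _ _ _).
by apply/seteqP; split=> x /= => [Cx|[]//]; split=> //; exists x.
Qed.

Lemma portly_preimage_nonempty : C !=set0 -> exists x, C (j x).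
Proof.
move=> C0; have [_ jdense _] := jportly.
by have [y [Cy [x _ xE]]] := jdense _ C0 oC; exists x; rewrite xE.
Qed.

End PortlyEmbedding.

Section CoveringPi1.
Local Open Scope quotient_scope.
Context (R : realType) (X Z : topologicalType) (q : X -> Z) (x0 : X).
Hypotheses (qcov : covering q) (Xsc : simply_connected R X)
  (Xlpc : locally_path_connected R X).
Implicit Types (W : set Z) (g : R -> X).

(** A class of paths is described by the lifts of its members that start
    at [x0], rather than by the lift of one chosen representative. *)
Definition represents W (c : pi1 R (q x0) W) g : Prop :=
  [/\ continuous g, g 0 = x0 & homotopic_to (q x0) W (\val (repr c)) (q \o g)].

(** The lift of a representative, projected again, agrees with it only on the
    unit interval, hence the constant homotopy. *)
Lemma pi1_represented W (c : pi1 R (q x0) W) : exists g, represents c g.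
Proof.
have /set_mem[cf f0 f1] := valP (repr c).
have [||g [cg g0 qg]] := @path_lifting _ _ _ qcov R (\val (repr c) \o clamp) x0.
- apply: continuous_within_comp cf _ _; first exact: continuous_clamp.
  by move=> s; exact: clamp_itv.
- by rewrite /= clamp_le0.
exists g; split=> //; exists (q \o g \o snd); split=> //=.
- apply/continuous_subspaceT/continuous_compT.
    by move=> z; exact: cvg_snd.
  by apply: continuous_compT => //; exact: qcov.1.
- by move=> t t01; rewrite qg/= !clamp_id.
- by move=> s _; split; [rewrite g0|rewrite qg/= !clamp_ge1].
Qed.

Lemma represents_end W (c : pi1 R (q x0) W) g : represents c g -> W (q (g 1)).
Proof.
have t01 : 1 \in `[0, 1 : R] by rewrite in_itv/= ler01 lexx.
by move=> [_ _ [H [_ _ H1 Hs]]]; have [_] := Hs _ t01; rewrite H1.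
Qed.

Lemma lift_represents W g : continuous g -> g 0 = x0 -> W (q (g 1)) ->
  exists c : pi1 R (q x0) W, represents c g.
Proof.
move=> cg g0 Wg.
have qgP : q \o g \in path_to R (q x0) W.
  rewrite inE; split; [|by rewrite /= g0|exact: Wg].
  by apply/continuous_subspaceT/continuous_compT => //; exact: qcov.1.
pose f : path_to R (q x0) W := exist _ (q \o g) qgP.
exists (\pi_(pi1 R (q x0) W) f); split=> //.
have : path_rel (repr (\pi_(pi1 R (q x0) W) f)) f.
  by apply/eqmodP; rewrite reprK.
by move=> /asboolP.
Qed.

Lemma represents_connected W (c : pi1 R (q x0) W) g g' :
  represents c g -> represents c g' ->
  exists E, [/\ connected E, E `<=` q @^-1` W, E (g 1) & E (g' 1)].
Proof.
move=> [cg g0 cqg] [cg' g'0 cqg'].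
apply: (homotopic_lifts_connected qcov) => //; first by rewrite g0 g'0.
by rewrite g0; exact: homotopic_to_trans (homotopic_to_sym cqg) cqg'.
Qed.

Lemma represents_inj W (c c' : pi1 R (q x0) W) g g' (E : set X) :
  represents c g -> represents c' g' ->
  open E -> connected E -> E `<=` q @^-1` W -> E (g 1) -> E (g' 1) -> c = c'.
Proof.
move=> [cg g0 cqg] [cg' g'0 cqg'] oE Econn EW Eg Eg'.
rewrite -[c]reprK -[c']reprK; apply/eqmodP/asboolP.
apply: homotopic_to_trans cqg _.
apply: homotopic_to_trans (homotopic_to_sym cqg').
rewrite -{1}g0; apply: (homotopic_of_lifts qcov Xsc Xlpc) oE _ _ _ _ => //.
by rewrite g0 g'0.
Qed.

Lemma represents_pi1_map W W' (WW' : W `<=` W') (c : pi1 R (q x0) W) g :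
  represents c g -> represents (pi1_map WW' c) g.
Proof.
move=> [cg g0 cqg]; split=> //.
have : path_rel (repr (pi1_map WW' c)) (path_incl WW' (repr c)).
  by apply/eqmodP; rewrite reprK.
move=> /asboolP /homotopic_to_trans; apply.
have [H [cH H0 H1 Hs]] := cqg.
by exists H; split=> // s /Hs[? /WW'].
Qed.

End CoveringPi1.

(** A point [x] of the covering space yields the component containing [j x].
    Components over [U] of the completion [X'] correspond to components over [U]
    of [X], because the range of [j] is portly. *)
Section Branched.
Context (R : realType) (Y : topologicalType) (S : set Y).
Context (X X' : topologicalType) (q : X -> (~` S : set Y)) (p : X' -> Y)
  (j : X -> X') (x0 : X).
Hypotheses (qcov : covering q) (Xsc : simply_connected R X)
  (Xlpc : locally_path_connected R X).
Hypotheses (pspread : spread p) (jemb : embedding j)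
  (pj : p \o j = set_val \o q) (jportly : portly (range j)).
Implicit Types (U V : set Y).

Definition pi1_component U (c : branched_pi1 R (q x0) U) : set X' :=
  [set x' | exists2 g, represents c g &
    connected_component (p @^-1` U) (j (g 1)) x'].

Let pjE x : p (j x) = set_val (q x).
Proof. by rewrite -[p (j x)]/((p \o j) x) pj. Qed.

Lemma pi1_componentE U (c : branched_pi1 R (q x0) U) g :
  represents c g -> pi1_component c = connected_component (p @^-1` U) (j (g 1)).
Proof.
move=> cg; apply/seteqP; split=> x'; last by exists g.
move=> [g' cg']; apply: connected_component_trans.
have [E [Econn EU Eg Eg']] := represents_connected qcov cg cg'.
have cj : continuous j.
  by apply/continuousP => O oO; apply/(jemb.2 _).2; exists O.
apply: (@connected_component_max _ _ (j @` E)); last by exists (g' 1).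
- by exists (g 1).
- by move=> _ [x Ex <-]; rewrite /preimage/= pjE; exact: EU.
- exact: connected_image.
Qed.

Let represents_fibre U (c : branched_pi1 R (q x0) U) g :
  represents c g -> (p @^-1` U) (j (g 1)).
Proof. by move=> /represents_end; rewrite /preimage/= pjE. Qed.

Lemma pi1_component_is_component U (c : branched_pi1 R (q x0) U) :
  is_component (p @^-1` U) (pi1_component c).
Proof.
have [g cg] := pi1_represented qcov c; rewrite (pi1_componentE cg).
exact/is_component_mem/(represents_fibre cg).
Qed.

Let component_open U C : open U -> is_component (p @^-1` U) C -> open C.
Proof. by move=> oU UC; have [_ [+ _]] := pspread; apply; exists U. Qed.

(** A component of the preimage of [U] in [X'] is still connected after removal
    of the points outside [X], so it gives a connected set in which to join the
    ends of two lifts. *)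
Lemma pi1_component_inj U : open U ->
  injective (@pi1_component U).
Proof.
move=> oU c c' cc'.
have [g cg] := pi1_represented qcov c; have [g' cg'] := pi1_represented qcov c'.
have Uc := pi1_component_is_component c.
have oC := component_open oU Uc; have Cconn := is_component_connected Uc.
apply: (represents_inj qcov Xsc Xlpc cg cg' (portly_preimage_open jemb oC)
  (portly_preimage_connected jemb jportly oC Cconn)).
- by move=> x /(is_component_sub Uc); rewrite /preimage/= pjE.
- rewrite /preimage/= (pi1_componentE cg).
  exact/connected_component_refl/(represents_fibre cg).
- rewrite /preimage/= cc' (pi1_componentE cg').
  exact/connected_component_refl/(represents_fibre cg').
Qed.

(** By density a component meets [X], and paths from [x0] reach all of [X]. *)
Lemma pi1_component_surj U C : open U -> is_component (p @^-1` U) C ->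
  exists c : branched_pi1 R (q x0) U, pi1_component c = C.
Proof.
move=> oU UC; have oC := component_open oU UC.
have [x Cx] := portly_preimage_nonempty jportly oC (is_component_nonempty UC).
have [_ Xpath _] := Xsc.
have [g [cg g0 g1 _]] :=
  path_connected_continuous Xpath (I : setT x0) (I : setT x).
have [|c cgP] := @lift_represents R _ _ q x0 qcov (set_val @^-1` U) g cg g0.
  by rewrite g1 /preimage/= -pjE; exact: is_component_sub UC _ Cx.
exists c; rewrite (pi1_componentE cgP) g1.
by rewrite -(is_componentE UC Cx).
Qed.

Lemma pi1_component_map U V (UV : U `<=` V) (c : branched_pi1 R (q x0) U) :
  pi1_component c `<=` pi1_component (branched_pi1_map UV c).
Proof.
have [g cg] := pi1_represented qcov c.
have cg' : represents (branched_pi1_map UV c) g by exact: represents_pi1_map.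
have cmem := pi1_component_is_component.
apply: (@is_component_mono _ _ _ _ _ (j (g 1)) (cmem _ _) (cmem _ _)).
- by rewrite (pi1_componentE cg);
    exact/connected_component_refl/(represents_fibre cg).
- by rewrite (pi1_componentE cg');
    exact/connected_component_refl/(represents_fibre cg').
- by move=> x; exact: UV.
Qed.

End Branched.

Theorem proposition2p29 (R : realType) (Y : topologicalType) (S : set Y)
    (hausY : hausdorff_space Y) (connY : connected [set: Y])
    (lpcY : locally_path_connected R Y) (fcY : first_countable Y)
    (skelS : skeletal S)
    (slscYS : semi_locally_simply_connected R (~` S : set Y))
    (a : (~` S : set Y))
    (YS : topologicalType) (p : YS -> Y)
    (hp : branched_universal_covering R S p)
    (b : Y) (B : set (set Y)) (hB : connected_nbhs_basis b B) :
  homeomorphic (p @^-1` [set b] : set YS) (branched_pi1_lim R a B).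
Proof.
have [[hausYS _ _] [X [q [j [[_ lpcX _] [qcov Xsc] jcompl]]]]] := hp.
have [_ pcs jemb pj jportly] := jcompl.
have [oS denseS lcS] := skelS.
have connYS : connected [set: (~` S : set Y)].
  by apply: connected_set_type; rewrite -[~` S]setTI; exact: lcS openT connY.
have [X0 _ _] := Xsc.
have [x0 qx0] := covering_surjective qcov X0 connYS a; subst a.
have bcl : closure (range p) b.
  move=> N; rewrite nbhsE => -[O [oO Ob] ON].
  have [z [Oz Sz]] := denseS O (ex_intro _ b Ob) oO.
  have [x qx] := covering_surjective qcov X0 connYS (exist _ z (mem_set Sz)).
  exists z; split; last exact: ON.
  by exists (j x) => //; rewrite -[p (j x)]/((p \o j) x) pj /= qx.
have oB (U : B) : open (\val U) by have [[]] := basis_open_nbhs hB U.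
have pspread := pcs.1.
apply: (@fibre_homeomorphic_projlim _ _ p b B pcs hausYS hausY hB bcl
  (fun U : B => branched_pi1 R (q x0) (\val U))
  (fun U V UV => branched_pi1_map UV)
  (fun U : B => @pi1_component R Y S X YS q p j x0 (\val U))).
- by move=> U c; exact: pi1_component_is_component.
- by move=> U; exact: pi1_component_inj.
- by move=> U C; exact: pi1_component_surj.
- by move=> U V UV c; exact: pi1_component_map.
Qed.
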